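(* Suppose the setting below holds, all local functions $f_i$ ($i=1,\dots,m$) are convex, the step sizes are $\gamma_k=\frac{2}{k+1}$, and the sample sizes satisfy Sampling Rule 1 for some epoch length $q\in\mathbb{Z}^+$. Let $x^*$ be an optimal solution of $\min_{x\in\Omega}F(x)$. Then $\mathbb{E}[F(\bar x^k)]-F(x^* )=\mathcal{O}(1/k)$.
   Context: Setting. Problem: minimize $F(x)=\frac1m\sum_{i=1}^m f_i(x)$ over $x\in\Omega\subset\mathbb{R}^d$, where $f_i(x)=\frac1{n_i}\sum_{j=1}^{n_i} f_{i,j}(x)$. Assumption 1: $\Omega$ is nonempty, convex and compact with diameter $\bar\rho=\max_{x,\hat x\in\Omega}\|x-\hat x\|$. Standing regularity: each $f_{i,j}$ is differentiable and $L$-smooth on a neighborhood of $\Omega$, each $f_i$ is $G$-Lipschitz on $\Omega$, and $\|\nabla f_i(x)\|\le C$ on $\Omega$. Assumption 2: connected undirected graph on $m$ agents; $W\in\mathbb{R}^{m\times m}$ symmetric, nonnegative, $W_{ij}=0$ unless $i=j$ or $\{i,j\}$ is an edge, doubly stochastic; $\lambda_2(W)$ denotes the largest modulus of eigenvalues of $W$ other than the simple eigenvalue $1$, and $|\lambda_2(W)|<1$. Algorithm DstoFW with step sizes $\gamma_k\in(0,1]$, epoch length $q\in\mathbb{Z}^+$ and sample sizes $|S^k|$: initialize $x_i^1\in\Omega$, $d_i^1=v_i^1=g_i^1=\nabla f_i(x_i^1)$. For $k=1,2,\dots$ each agent $i$: $\overline{x_i^k}=\sum_{j=1}^m W_{ij}x_j^k$;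 $u_i^k\in\arg\min_{u\in\Omega}\langle u,d_i^k\rangle$; $x_i^{k+1}=(1-\gamma_k)\overline{x_i^k}+\gamma_k u_i^k$; if $(k+1)\bmod q=0$ then $v_i^{k+1}=\frac1{n_i}\sum_{j=1}^{n_i}\nabla f_{i,j}(x_i^{k+1})$, else draw a sample set $S^k$ from $[n_i]$ uniformly at random (independently of the past) and set $v_i^{k+1}=\frac1{|S^k|}\sum_{j\in S^k}[\nabla f_{i,j}(x_i^{k+1})-\nabla f_{i,j}(x_i^k)]+v_i^k$; $g_i^{k+1}=d_i^k+v_i^{k+1}-v_i^k$; $d_i^{k+1}=\sum_{j=1}^m W_{ij}g_j^{k+1}$. Notation: $\bar x^k=\frac1m\sum_ix_i^k$; expectations are over the random sampling. Sampling Rule 1: for every $\tilde n\in\mathbb{Z}^+$, $\sqrt{|S^{\tilde nq-1}|}=q$, and for every integer $k$ with $(\tilde n-1)q+1\le k<\tilde nq-1$, $\sqrt{1/|S^k|}\,\gamma_k\le\sqrt{1/|S^{k+1}|}\,\gamma_{k+1}$. *)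

(* Defs.v *)
From HB Require Import structures.
From mathcomp Require Import all_boot all_order all_algebra.
From mathcomp Require Import all_classical all_reals all_analysis.
Set Implicit Arguments. Unset Strict Implicit. Unset Printing Implicit Defensive.
Import Order.TTheory GRing.Theory Num.Theory.
Import numFieldNormedType.Exports.
Local Open Scope classical_set_scope.
Local Open Scope ring_scope.

Section DstoFW.
Variables (R : realType) (d : nat).
Local Notation vec := 'rV[R]_d.

Definition dotv (u v : vec) : R := \sum_(l < d) u 0 l * v 0 l.
Definition enorm (u : vec) : R := Num.sqrt (dotv u u).

Definition grad (f : vec -> R) (x : vec) : vec :=
  \row_(l < d) ('D_(delta_mx 0 l) f x).

Definition convex_setv (Om : set vec) : Prop :=
  forall x y, Om x -> Om y -> forall t : R, 0 <= t <= 1 ->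
    Om ((1 - t) *: x + t *: y).

Definition convex_fun_on (Om : set vec) (f : vec -> R) : Prop :=
  forall x y, Om x -> Om y -> forall t : R, 0 <= t <= 1 ->
    f ((1 - t) *: x + t *: y) <= (1 - t) * f x + t * f y.

Definition smooth_near (Om : set vec) (L : R) (f : vec -> R) : Prop :=
  exists U : set vec, open U /\ Om `<=` U /\
    (forall x, U x -> differentiable f x) /\
    (forall x y, U x -> U y -> enorm (grad f x - grad f y) <= L * enorm (x - y)).

Definition lipschitz_on_set (Om : set vec) (G : R) (f : vec -> R) : Prop :=
  forall x y, Om x -> Om y -> `|f x - f y| <= G * enorm (x - y).

Definition lmo_spec (Om : set vec) (dv u : vec) : Prop :=
  Om u /\ forall w, Om w -> dotv u dv <= dotv w dv.

Variables (m : nat) (n : 'I_m -> nat).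

Definition floc (fij : forall i : 'I_m, 'I_(n i) -> vec -> R) (i : 'I_m) (x : vec) : R :=
  (n i)%:R^-1 * \sum_(j < n i) fij i j x.
Definition Fglob (fij : forall i : 'I_m, 'I_(n i) -> vec -> R) (x : vec) : R :=
  m%:R^-1 * \sum_(i < m) floc fij i x.

(* one sampling outcome at a given iteration: for every agent i, an ordered
   minibatch of size sz of indices drawn from [n_i] (with replacement) *)
Definition Samp (sz : nat) := {dffun forall i : 'I_m, {ffun 'I_sz -> 'I_(n i)}}.

Definition state := 'I_m -> vec * vec * vec.
Definition sx (st : state) i := (st i).1.1.
Definition sd (st : state) i := (st i).1.2.
Definition sv (st : state) i := (st i).2.

Definition xbar (st : state) : vec := m%:R^-1 *: \sum_(i < m) sx st i.

Variables (fij : forall i : 'I_m, 'I_(n i) -> vec -> R) (W : 'M[R]_m)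
  (lmo : nat -> 'I_m -> vec -> vec) (q : nat) (gam : nat -> R) (s : nat -> nat).

Definition init_state (x1 : 'I_m -> vec) : state :=
  fun i => (x1 i, grad (floc fij i) (x1 i), grad (floc fij i) (x1 i)).

Definition dstep (k : nat) (st : state) (S : Samp (s k)) : state :=
  let x := sx st in let dd := sd st in let v := sv st in
  let xb (i : 'I_m) := \sum_(j < m) W i j *: x j in
  let xn (i : 'I_m) := (1 - gam k) *: xb i + gam k *: lmo k i (dd i) in
  let vn (i : 'I_m) : vec :=
    if (k.+1 %% q == 0)%N then
      (n i)%:R^-1 *: \sum_(j < n i) grad (@fij i j) (xn i)
    else
      (s k)%:R^-1 *: \sum_(p < s k)
          (grad (@fij i (S i p)) (xn i) - grad (@fij i (S i p)) (x i)) + v i in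
  let gn (i : 'I_m) := dd i + vn i - v i in
  let dn (i : 'I_m) := \sum_(j < m) W i j *: gn j in
  fun i => (xn i, dn i, vn i).

(* expectation of g(state after r more iterations), starting from state st at
   iteration k, all minibatches being drawn independently and uniformly *)
Fixpoint expect_from (r k : nat) (g : state -> R) (st : state) : R :=
  match r with
  | 0 => g st
  | r'.+1 => #|{: Samp (s k)}|%:R^-1 *
       \sum_(S : Samp (s k)) expect_from r' k.+1 g (@dstep k st S)
  end.

(* E[ g(state at iteration K) ], K >= 1 *)
Definition expect_at (x1 : 'I_m -> vec) (K : nat) (g : state -> R) : R :=
  expect_from K.-1 1 g (init_state x1).

End DstoFW.

Definition mixing {R : realType} (m : nat) (adj : rel 'I_m) (W : 'M[R]_m) : Prop :=
  (forall i j, adj i j = adj j i) /\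
  (forall i j, connect adj i j) /\
  W^T = W /\
  (forall i j, 0 <= W i j) /\
  (forall i j, i != j -> ~~ adj i j -> W i j = 0) /\
  (forall i, \sum_(j < m) W i j = 1) /\
  (forall j, \sum_(i < m) W i j = 1).

(* 1 is a simple eigenvalue and |lambda_2(W)| < 1: every other eigenvalue has
   modulus < 1 (W symmetric real, so all eigenvalues are real) *)
Definition lambda2_lt1 {R : realType} (m : nat) (W : 'M[R]_m) : Prop :=
  \rank (eigenspace W 1) = 1%N /\
  (forall a : R, eigenvalue W a -> a != 1 -> `|a| < 1).

Definition sampling_rule1 {R : realType} (q : nat) (s : nat -> nat) (gam : nat -> R) : Prop :=
  (forall nt : nat, (0 < nt)%N -> Num.sqrt ((s (nt * q - 1)%N)%:R) = q%:R :> R) /\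
  (forall nt k : nat, (0 < nt)%N -> ((nt - 1) * q + 1 <= k)%N -> (k < nt * q - 1)%N ->
     Num.sqrt ((s k)%:R^-1) * gam k <= Num.sqrt ((s k.+1)%:R^-1) * gam k.+1).

(* Main.v *)
Require Import Defs.
From HB Require Import structures.
From mathcomp Require Import all_boot all_order all_algebra.
From mathcomp Require Import all_classical all_reals all_analysis.
From mathcomp Require Import ring lra.
Set Implicit Arguments. Unset Strict Implicit. Unset Printing Implicit Defensive.
Import Order.TTheory GRing.Theory Num.Theory.
Import numFieldNormedType.Exports.
Local Open Scope classical_set_scope.
Local Open Scope ring_scope.

(** The bound holds on every sample path, not only in expectation, because the
    epoch length [q] is fixed. Consensus and the steps [gam k <= 2 / k] give
    [|x_i^{k+1} - x_i^k| = O(1/k)]; a mini-batch correction changes the error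
    [v_i - grad f_i (x_i)] by at most [2 L |x_i^{k+1} - x_i^k|], and the error is
    reset to [0] at least once every [q] iterations, so it stays [O(1/k)].
    [W] contracts the deviations of the [x_i] and of the [d_i] from their
    averages by a factor [lam < 1], so these are [O(1/k)] as well. Hence every [d_i]
    is within [O(1/k)] of the gradient of [F] at the average iterate [xbar_k],
    and the Frank-Wolfe inequality for [h_k = F xbar_k - F xstar],
    [h_{k+1} <= (1 - 2/(k+1)) h_k + B/k^2] yields [h_k = O(1/k)]. The constants
    do not depend on the samples, so averaging over them is harmless. *)

(** * Euclidean norms and averages *)

Section l2norm.
Variables (R : rcfType) (I : finType).
Implicit Types f g : I -> R.

Definition l2 f : R := Num.sqrt (\sum_i f i ^+ 2).

Lemma sum_sqr_ge0 f : 0 <= \sum_i f i ^+ 2.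
Proof. by apply: sumr_ge0 => i _; exact: sqr_ge0. Qed.

Lemma l2_ge0 f : 0 <= l2 f.
Proof. exact: sqrtr_ge0. Qed.

Lemma sqr_l2 f : l2 f ^+ 2 = \sum_i f i ^+ 2.
Proof. by rewrite sqr_sqrtr // sum_sqr_ge0. Qed.

Lemma l2_eq0 f : l2 f = 0 -> forall i, f i = 0.
Proof.
move=> f0 i; have := sqr_l2 f; rewrite f0 expr0n /= => /esym/eqP.
rewrite psumr_eq0 => [/allP/(_ i (mem_index_enum i))|j _]; last exact: sqr_ge0.
by rewrite sqrf_eq0 => /eqP.
Qed.

(** Cauchy-Schwarz: expand the nonnegative sum of the squares [(l2 g * f i - l2 f * g i) ^+ 2] and
    cancel the factor [l2 f * l2 g]. If that factor vanishes, one family is identically zero. *)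
Lemma l2_dot f g : \sum_i f i * g i <= l2 f * l2 g.
Proof.
have [f0|f0] := eqVneq (l2 f) 0.
  by rewrite f0 mul0r big1 // => i _; rewrite l2_eq0 // mul0r.
have [g0|g0] := eqVneq (l2 g) 0.
  by rewrite g0 mulr0 big1 // => i _; rewrite (l2_eq0 g0) mulr0.
have fg0 : 0 < l2 f * l2 g by rewrite mulr_gt0 // lt_neqAle l2_ge0 eq_sym ?f0 ?g0.
have : 0 <= \sum_i (l2 g * f i - l2 f * g i) ^+ 2.
  by apply: sumr_ge0 => i _; exact: sqr_ge0.
have -> : \sum_i (l2 g * f i - l2 f * g i) ^+ 2 =
    l2 g ^+ 2 * \sum_i f i ^+ 2 - 2 * l2 f * l2 g * (\sum_i f i * g i)
    + l2 f ^+ 2 * \sum_i g i ^+ 2.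
  by rewrite !mulr_sumr -sumrB -big_split; apply: eq_bigr => i _ /=; ring.
rewrite -!sqr_l2; set S := \sum_i _ => S0.
have {S0} : 0 <= l2 f * l2 g * (l2 f * l2 g - S) by nra.
by rewrite pmulr_rge0 // subr_ge0.
Qed.

Lemma l2_le f g : (forall i, 0 <= f i <= g i) -> l2 f <= l2 g.
Proof.
move=> fg; rewrite ler_sqrt ?sum_sqr_ge0 //; apply: ler_sum => i _.
by have /andP[f0 fgi] := fg i; rewrite ler_sqr ?nnegrE // (le_trans f0).
Qed.

Lemma l2D f g : l2 (fun i => f i + g i) <= l2 f + l2 g.
Proof.
rewrite -(@ler_pXn2r _ 2) ?nnegrE ?addr_ge0 ?l2_ge0 //.
have -> : l2 (fun i => f i + g i) ^+ 2 =
    l2 f ^+ 2 + l2 g ^+ 2 + 2 * \sum_i f i * g i.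
  by rewrite !sqr_l2 mulr_sumr -!big_split; apply: eq_bigr => i _ /=; ring.
by have := l2_dot f g; nra.
Qed.

Lemma l2Z c f : 0 <= c -> l2 (fun i => c * f i) = c * l2 f.
Proof.
move=> c0; rewrite /l2; under eq_bigr => i _ do rewrite exprMn.
by rewrite -mulr_sumr sqrtrM ?sqr_ge0 // sqrtr_sqr ger0_norm.
Qed.

Lemma ler_l2 f i : `|f i| <= l2 f.
Proof.
rewrite -sqrtr_sqr ler_sqrt ?sum_sqr_ge0 // (bigD1 i) //= lerDl.
by apply: sumr_ge0 => j _; exact: sqr_ge0.
Qed.

Lemma l2_const c : 0 <= c -> l2 (fun=> c) <= #|I|%:R * c.
Proof.
move=> c0; rewrite -(@ler_pXn2r _ 2) ?nnegrE ?l2_ge0 ?mulr_ge0 ?ler0n //.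
rewrite sqr_l2 sumr_const exprMn -[leLHS]mulr_natl ler_wpM2r ?sqr_ge0 //.
by rewrite -natrX ler_nat; case: #|_| => // k; rewrite expnS expn1 leq_pmulr.
Qed.

End l2norm.

Section euclidean.
Variables (R : realType) (d : nat).
Implicit Types (u v w : 'rV[R]_d) (c : R).

Lemma dotvC u v : dotv u v = dotv v u.
Proof. by apply: eq_bigr => l _; rewrite mulrC. Qed.

Lemma dotvDr u v w : dotv u (v + w) = dotv u v + dotv u w.
Proof. by rewrite -big_split; apply: eq_bigr => l _; rewrite mxE mulrDr. Qed.

Lemma dotvZr c u v : dotv u (c *: v) = c * dotv u v.
Proof. by rewrite mulr_sumr; apply: eq_bigr => l _; rewrite mxE; ring. Qed.

Lemma dotvBr u v w : dotv u (v - w) = dotv u v - dotv u w.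
Proof. by rewrite -scaleN1r dotvDr dotvZr mulN1r. Qed.

Lemma dotvBl u v w : dotv (u - v) w = dotv u w - dotv v w.
Proof. by rewrite !(dotvC _ w) dotvBr. Qed.

Lemma dotvZl c u v : dotv (c *: u) v = c * dotv u v.
Proof. by rewrite !(dotvC _ v) dotvZr. Qed.

Lemma dotv0r u : dotv u 0 = 0.
Proof. by rewrite -(scale0r 0) dotvZr mul0r. Qed.

Lemma dotv_sumr (I : finType) u (F : I -> 'rV[R]_d) :
  dotv u (\sum_i F i) = \sum_i dotv u (F i).
Proof.
by apply: (big_morph (dotv u)); [exact: dotvDr|exact: dotv0r].
Qed.

Lemma dotv_suml (I : finType) u (F : I -> 'rV[R]_d) :
  dotv (\sum_i F i) u = \sum_i dotv (F i) u.
Proof. by rewrite dotvC dotv_sumr; apply: eq_bigr => i _; rewrite dotvC. Qed.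

Lemma enormE u : enorm u = l2 (u 0).
Proof. by []. Qed.

Lemma enorm_ge0 u : 0 <= enorm u.
Proof. exact: l2_ge0. Qed.

Lemma dotv_le u v : dotv u v <= enorm u * enorm v.
Proof. exact: l2_dot. Qed.

Lemma ler_enormD u v : enorm (u + v) <= enorm u + enorm v.
Proof.
rewrite !enormE (_ : (u + v) 0 = fun l => u 0 l + v 0 l) ?l2D //.
by apply/funext => l; rewrite mxE.
Qed.

Lemma enormZ c u : enorm (c *: u) = `|c| * enorm u.
Proof.
by rewrite /enorm dotvZl dotvZr mulrA sqrtrM ?sqr_ge0 // -expr2 sqrtr_sqr.
Qed.

Lemma enorm0 : enorm (0 : 'rV[R]_d) = 0.
Proof. by rewrite -(scale0r 0) enormZ normr0 mul0r. Qed.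

Lemma enormN u : enorm (- u) = enorm u.
Proof. by rewrite -scaleN1r enormZ normrN1 mul1r. Qed.

Lemma enormBC u v : enorm (u - v) = enorm (v - u).
Proof. by rewrite -enormN opprB. Qed.

Lemma ler_enormB u v : enorm (u - v) <= enorm u + enorm v.
Proof. by rewrite -(enormN v) ler_enormD. Qed.

Lemma ler_dist_enormD w u v : enorm (u - v) <= enorm (u - w) + enorm (w - v).
Proof. by rewrite (_ : u - v = (u - w) + (w - v)) ?ler_enormD // addrA subrK. Qed.

Lemma ler_norm_dotv u v : `|dotv u v| <= enorm u * enorm v.
Proof.
rewrite ler_norml dotv_le andbT lerNl -mulN1r -dotvZl scaleN1r.
by rewrite (le_trans (dotv_le _ _)) // enormN.
Qed.

Lemma ler_enorm_sum (I : finType) (F : I -> 'rV[R]_d) :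
  enorm (\sum_i F i) <= \sum_i enorm (F i).
Proof.
elim/big_ind2 : _ => [|x1 x2 y1 y2 h1 h2|//]; first by rewrite enorm0.
by rewrite (le_trans (ler_enormD _ _)) // lerD.
Qed.

End euclidean.

(** * Averages over the agents and deviations from them *)

Section average.
Variables (R : realType) (d m : nat).
Implicit Types (x y : 'I_m -> 'rV[R]_d).

Definition avg x : 'rV[R]_d := m%:R^-1 *: \sum_i x i.

Definition fnorm x : R := l2 (fun i => enorm (x i)).

(** The consensus error: the Frobenius norm of the stacked deviations from the average. *)
Definition spread x : R := fnorm (fun i => x i - avg x).

Lemma enorm_fnorm x i : enorm (x i) <= fnorm x.
Proof.
by apply: le_trans (ler_l2 (fun i => enorm (x i)) i); exact: ler_norm.
Qed.

Lemma fnormD x y : fnorm (fun i => x i + y i) <= fnorm x + fnorm y.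
Proof.
by apply: le_trans (l2D _ _); apply: l2_le => i; rewrite enorm_ge0 ler_enormD.
Qed.

Lemma fnormZ c x : fnorm (fun i => c *: x i) = `|c| * fnorm x.
Proof.
by rewrite -l2Z //; congr l2; apply/funext => i; rewrite enormZ.
Qed.

Lemma fnorm_le x c : 0 <= c -> (forall i, enorm (x i) <= c) -> fnorm x <= m%:R * c.
Proof.
move=> c0 xc; have := @l2_const R 'I_m c c0; rewrite card_ord; apply: le_trans.
by apply: l2_le => i; rewrite enorm_ge0 xc.
Qed.

Lemma avgD x y : avg (fun i => x i + y i) = avg x + avg y.
Proof. by rewrite /avg big_split scalerDr. Qed.

Lemma avgZ c x : avg (fun i => c *: x i) = c *: avg x.
Proof. by rewrite /avg -scaler_sumr !scalerA mulrC. Qed.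

Lemma avgB x y : avg (fun i => x i - y i) = avg x - avg y.
Proof. by rewrite /avg sumrB scalerBr. Qed.

Lemma spread_enorm x i : enorm (x i - avg x) <= spread x.
Proof. exact: (enorm_fnorm (fun i => x i - avg x)). Qed.

Lemma spread_ge0 x : 0 <= spread x.
Proof. exact: l2_ge0. Qed.

Lemma spreadD x y : spread (fun i => x i + y i) <= spread x + spread y.
Proof.
apply: le_trans (fnormD _ _); rewrite /spread avgD.
rewrite (_ : (fun i => _) = fun i => (x i - avg x) + (y i - avg y)) //.
by apply/funext => i; rewrite opprD addrACA.
Qed.

Lemma spreadZ c x : spread (fun i => c *: x i) = `|c| * spread x.
Proof.
by rewrite -fnormZ /spread avgZ; congr fnorm; apply/funext => i; rewrite scalerBr.
Qed.

Hypothesis m0 : (0 < m)%N.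

Lemma avg_const (u : 'rV[R]_d) : avg (fun=> u) = u.
Proof.
rewrite /avg sumr_const card_ord -[u *+ m]scaler_nat scalerA mulVf ?scale1r //.
by rewrite pnatr_eq0 -lt0n.
Qed.

Lemma avgBc x (u : 'rV[R]_d) : avg (fun i => x i - u) = avg x - u.
Proof. by rewrite avgB avg_const. Qed.

Lemma sum_centered x : \sum_i (x i - avg x) = 0.
Proof.
have : avg (fun i => x i - avg x) = 0 by rewrite avgBc subrr.
move/eqP; rewrite scaler_eq0 invr_eq0 pnatr_eq0 -[_ == 0%N]negbK -lt0n m0 /=.
by move/eqP.
Qed.

Lemma avg_le x c : (forall i, enorm (x i) <= c) -> enorm (avg x) <= c.
Proof.
move=> xc; rewrite enormZ ger0_norm ?invr_ge0 ?ler0n //.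
rewrite mulrC ler_pdivrMr ?ltr0n //; apply: le_trans (ler_enorm_sum _) _.
apply: le_trans (ler_sum _ (fun i _ => xc i)) _.
by rewrite sumr_const card_ord mulr_natr.
Qed.

Lemma spread_le x c : 0 <= c -> (forall i, enorm (x i) <= c) -> spread x <= m%:R * (2 * c).
Proof.
move=> c0 xc; apply: fnorm_le => [|i]; first by rewrite mulr_ge0.
by rewrite (le_trans (ler_enormB _ _)) // mulr_natl mulr2n lerD // avg_le.
Qed.

End average.

(** * The mixing matrix *)

Section mixing_contraction.
Variables (R : realType) (m : nat) (adj : rel 'I_m) (W : 'M[R]_m).
Hypotheses (m0 : (0 < m)%N) (Wmix : mixing adj W) (Wgap : lambda2_lt1 W).
Implicit Types y : 'rV[R]_m.

Let Wsym : W^T = W. Proof. by case: Wmix => _ [_ []]. Qed.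
Let Wge0 i j : 0 <= W i j. Proof. by case: Wmix => _ [_ [_ [+ _]]]; exact. Qed.
Let Wrow i : \sum_j W i j = 1.
Proof. by case: Wmix => _ [_ [_ [_ [_ [+ _]]]]]; exact. Qed.

Let WsymE i j : W i j = W j i. Proof. by rewrite -[in LHS]Wsym mxE. Qed.

Let mulWE y i : (y *m W) 0 i = \sum_j W i j * y 0 j.
Proof. by rewrite mxE; apply: eq_bigr => j _; rewrite mulrC WsymE. Qed.

Let dotv_mulW y z : dotv (y *m W) z = dotv y (z *m W).
Proof.
rewrite /dotv; under eq_bigr => i _ do rewrite mulWE mulr_suml.
under [RHS]eq_bigr => i _ do rewrite mulWE mulr_sumr.
rewrite exchange_big /=; apply: eq_bigr => i _; apply: eq_bigr => j _.
by rewrite WsymE; ring.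
Qed.

Let sum_mulW y : \sum_i (y *m W) 0 i = \sum_i y 0 i.
Proof.
under eq_bigr => i _ do rewrite mulWE.
rewrite exchange_big /=; apply: eq_bigr => j _.
by under eq_bigr => i _ do rewrite WsymE; rewrite -mulr_suml Wrow mul1r.
Qed.

(** Each row of [W] is a probability vector, so Jensen's inequality for the square applies row by
    row (the weighted variance is nonnegative); summing over the rows uses that the columns sum to
    one as well. *)
Let mulW_nonexpansive y : dotv (y *m W) (y *m W) <= dotv y y.
Proof.
have jensen i : (y *m W) 0 i * (y *m W) 0 i <= \sum_j W i j * (y 0 j * y 0 j).
  set a := (y *m W) 0 i.
  have : 0 <= \sum_j W i j * (y 0 j - a) ^+ 2.
    by apply: sumr_ge0 => j _; rewrite mulr_ge0 ?Wge0 ?sqr_ge0.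
  have -> : \sum_j W i j * (y 0 j - a) ^+ 2 =
      \sum_j W i j * (y 0 j * y 0 j) - 2 * a * (\sum_j W i j * y 0 j)
      + a ^+ 2 * \sum_j W i j.
    by rewrite !mulr_sumr -sumrB -big_split; apply: eq_bigr => j _ /=; ring.
  by rewrite -mulWE -/a Wrow; nra.
apply: le_trans (ler_sum _ (fun i _ => jensen i)) _.
rewrite exchange_big /= le_eqVlt; apply/orP; left; apply/eqP.
apply: eq_bigr => j _; under eq_bigr => i _ do rewrite WsymE.
by rewrite -mulr_suml Wrow mul1r.
Qed.

(** The eigenspace for 1 has rank one and contains the all-ones vector, so fixed vectors are
    constant, and a constant vector of zero sum vanishes. *)
Let fixed_mean0 y : y *m W = y -> \sum_i y 0 i = 0 -> y = 0.
Proof.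
move=> yW y0; case: Wgap => r1 _.
pose e : 'rV[R]_m := const_mx 1.
have eW : (e <= eigenspace W 1)%MS.
  apply/eigenspaceP; rewrite scale1r; apply/rowP => i; rewrite mulWE mxE.
  by under eq_bigr => j _ do rewrite mxE mulr1.
have e0 : e != 0.
  apply/eqP => /rowP /(_ (Ordinal m0)); rewrite !mxE => /eqP.
  by rewrite oner_eq0.
have re : \rank e = 1%N by rewrite rank_rV e0.
have : (eigenspace W 1 <= e)%MS.
  by rewrite -(mxrank_leqif_sup eW) re r1.
have : (y <= eigenspace W 1)%MS by apply/eigenspaceP; rewrite scale1r.
move=> /submx_trans/[apply]/sub_rVP[a ya].
move: y0; rewrite ya; under eq_bigr => i _ do rewrite !mxE mulr1.
rewrite sumr_const card_ord => /eqP.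
by rewrite mulrn_eq0 eqn0Ngt m0 /= => /eqP ->; rewrite scale0r.
Qed.

(* Equality in [mulW_nonexpansive] forces [y W^2 = y], so [y W + y] is fixed by
   [W], hence zero, and [-1] would be an eigenvalue. *)
Let mulW_strict y : \sum_i y 0 i = 0 -> dotv (y *m W) (y *m W) = dotv y y ->
  y = 0.
Proof.
move=> y0 yy; pose z := y *m W *m W.
have zy : z = y.
  apply/eqP; rewrite -subr_eq0; apply/eqP/rowP => i; rewrite [RHS]mxE.
  apply: (@l2_eq0 _ _ ((z - y) 0)).
  apply/eqP; rewrite -sqrf_eq0 eq_le sqr_ge0 andbT sqr_l2.
  rewrite (_ : \sum_i _ = dotv (z - y) (z - y)); last first.
    by apply: eq_bigr => j _; rewrite expr2.
  (* The squared distance is [|z|^2 - 2 <z,y> + |y|^2]. By symmetry of [W], [<z,y>] equals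
     [|y W|^2 = |y|^2], and [|z|^2 <= |y|^2] by nonexpansiveness, so the total is at most 0. *)
  rewrite dotvBl !dotvBr (dotvC y z).
  have -> : dotv z y = dotv y y by rewrite dotv_mulW yy.
  by have := mulW_nonexpansive (y *m W); rewrite yy -/z; nra.
have : y *m W + y = 0.
  apply: fixed_mean0; first by rewrite mulmxDl -/z zy addrC.
  under eq_bigr => i _ do rewrite mxE.
  by rewrite big_split /= sum_mulW y0 addr0.
move=> /eqP; rewrite addr_eq0 => /eqP yW.
apply: contraTeq isT => yn0; case: Wgap => _ /(_ (-1)).
rewrite normrN1 ltxx => H; have : false; last by [].
apply: H; last by rewrite eq_sym -subr_eq0 opprK -(natrD _ 1 1) pnatr_eq0.
by apply/eigenvalueP; exists y => //; rewrite yW scaleN1r.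
Qed.

Let continuous_coord_sum (F : 'I_m -> 'rV[R]_m -> R) :
  (forall i, continuous (F i)) -> continuous (fun y => \sum_i F i y).
Proof. by move=> cF; apply: continuous_big => //; exact: add_continuous. Qed.

Let mean0_sphere : set 'rV[R]_m :=
  [set y | \sum_i y 0 i = 0 /\ \sum_i y 0 i ^+ 2 = 1].

Let compact_mean0_sphere : compact mean0_sphere.
Proof.
apply: bounded_closed_compact.
  exists 1; split => // M M1 y [_ y1] /=.
  rewrite /Num.norm /= mx_normrE; apply: bigmax_le => [|[i j] _ /=].
    by rewrite (le_trans _ (ltW M1)).
  rewrite ord1 (le_trans (ler_l2 (y 0) j)) // /l2 y1 sqrtr1; exact: ltW.
have coord i : continuous (fun y : 'rV[R]_m => y 0 i).
  exact: coord_continuous.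
have -> : mean0_sphere = (fun y => \sum_i y 0 i) @^-1` [set 0] `&`
    (fun y => \sum_i y 0 i ^+ 2) @^-1` [set 1] by [].
have cd := continuous_coord_sum coord.
have cd2 : continuous (fun y : 'rV[R]_m => \sum_i y 0 i ^+ 2).
  apply: (@continuous_coord_sum (fun i z => z 0 i ^+ 2)) => i z.
  exact: (continuousM (coord i z) (coord i z)).
by apply: closedI; apply: preimage_closed.
Qed.

(** Compactness makes the strict decrease uniform: [lam] is the largest value of [enorm (y *m W)]
    over unit vectors of zero sum. It is attained, hence below 1, and homogeneity extends the bound
    to all vectors of zero sum. *)
Lemma mixing_contraction : exists2 lam, 0 <= lam < 1 &
  forall y, \sum_i y 0 i = 0 -> enorm (y *m W) <= lam * enorm y.
Proof.
have normalize y : \sum_i y 0 i = 0 -> enorm y != 0 ->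
    mean0_sphere ((enorm y)^-1 *: y).
  move=> y0 yn0; split.
    by under eq_bigr => i _ do rewrite mxE; rewrite -mulr_sumr y0 mulr0.
  rewrite -sqr_l2 -enormE enormZ normfV ger0_norm ?enorm_ge0 // mulVf //.
  by rewrite expr1n.
have trivial_case y (lam : R) : enorm y = 0 -> enorm (y *m W) <= lam * enorm y.
  move=> y0; have -> : y = 0.
    by apply/rowP => i; rewrite mxE; exact: (@l2_eq0 _ _ (y 0)).
  by rewrite mul0mx enorm0 mulr0.
(* The sphere is empty for a single agent; then zero is the only vector of zero sum and any factor
   works. *)
have [S0|S0] := pselect (mean0_sphere !=set0); last first.
  exists 0; first by rewrite lexx ltr01.
  move=> y y0; have [/trivial_case//|yn0] := eqVneq (enorm y) 0.
  by case: S0; exists ((enorm y)^-1 *: y); exact: normalize.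
have cW : continuous (fun y : 'rV[R]_m => dotv (y *m W) (y *m W)).
  have cWi i : continuous (fun y : 'rV[R]_m => (y *m W) 0 i).
    rewrite (_ : (fun y : 'rV[R]_m => _) =
      (fun y : 'rV[R]_m => \sum_j W i j * y 0 j)); last first.
      by apply/funext => y; rewrite mulWE.
    apply: (@continuous_coord_sum (fun j y => W i j * y 0 j)) => j y.
    exact: (continuousM (cvg_cst (W i j)) (@coord_continuous _ _ _ 0 j y)).
  apply: (@continuous_coord_sum (fun i y => (y *m W) 0 i * (y *m W) 0 i)).
  by move=> i y; exact: (continuousM (cWi i y) (cWi i y)).
have [c /set_mem[c0 c1] cmax] := compact_EVT_max S0 compact_mean0_sphere
  (continuous_subspaceT cW).
have cc : dotv c c = 1.
  by rewrite -[RHS]c1; apply: eq_bigr => i _; rewrite expr2.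
have lam1 : dotv (c *m W) (c *m W) < 1.
  rewrite lt_neqAle -[X in _ <= X]cc mulW_nonexpansive andbT.
  apply/eqP; rewrite -[X in _ = X]cc => /(mulW_strict c0) c00.
  by move: cc; rewrite c00 dotv0r => /eqP; rewrite eq_sym oner_eq0.
exists (enorm (c *m W)).
  by rewrite enorm_ge0 -sqrtr1 ltr_sqrt.
move=> y y0; have [/trivial_case//|yn0] := eqVneq (enorm y) 0.
have yp : 0 < enorm y by rewrite lt_neqAle eq_sym yn0 enorm_ge0.
rewrite -ler_pdivrMr // mulrC.
have /ler_wsqrtr := cmax _ (mem_set (normalize y y0 yn0)).
by rewrite -!/(enorm _) -scalemxAl enormZ normfV ger0_norm ?enorm_ge0.
Qed.

End mixing_contraction.

(** * Contraction of vector-valued families under mixing *)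

Section mixing_spread.
Variables (R : realType) (m : nat) (adj : rel 'I_m) (W : 'M[R]_m).
Hypotheses (m0 : (0 < m)%N) (Wmix : mixing adj W).

Definition mix d (x : 'I_m -> 'rV[R]_d) (i : 'I_m) := \sum_j W i j *: x j.

Lemma avg_mix d (x : 'I_m -> 'rV[R]_d) : avg (mix x) = avg x.
Proof.
case: Wmix => _ [_ [_ [_ [_ [_ Wcol]]]]].
rewrite /avg exchange_big /=; congr (_ *: _); apply: eq_bigr => j _.
by rewrite -scaler_suml Wcol scale1r.
Qed.

Lemma fnorm_cols d (x : 'I_m -> 'rV[R]_d) :
  fnorm x = l2 (fun l => enorm (\row_i x i 0 l)).
Proof.
rewrite /fnorm /l2; congr Num.sqrt.
under eq_bigr => i _ do rewrite enormE sqr_l2.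
rewrite exchange_big; apply: eq_bigr => l _ /=.
by rewrite enormE sqr_l2; apply: eq_bigr => i _; rewrite mxE.
Qed.

(** Mixing acts separately on each coordinate, and for each coordinate the deviations form a vector
    of zero sum. The scalar contraction therefore applies column by column, and [fnorm_cols]
    reassembles the norm. *)
Lemma mixing_spread : lambda2_lt1 W -> exists2 lam, 0 <= lam < 1 &
  forall d (x : 'I_m -> 'rV[R]_d), spread (mix x) <= lam * spread x.
Proof.
move=> /(mixing_contraction m0 Wmix)[lam lam01 Wlam]; exists lam => // d x.
case: Wmix => _ [_ [Wsym [_ [_ [Wrow _]]]]].
have -> : spread (mix x) = fnorm (mix (fun i => x i - avg x)).
  congr fnorm; apply/funext => i; rewrite avg_mix /mix.
  under [RHS]eq_bigr => j _ do rewrite scalerBr.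
  by rewrite sumrB -scaler_suml Wrow scale1r.
have lam0 : 0 <= lam by case/andP: lam01.
rewrite /spread; set z := fun i => x i - avg x.
have z0 : \sum_i z i = 0 by exact: sum_centered.
rewrite !fnorm_cols -l2Z //.
apply: l2_le => l; rewrite enorm_ge0 /=.
have -> : \row_i mix z i 0 l = (\row_i z i 0 l) *m W.
  apply/rowP => i; rewrite !mxE summxE; apply: eq_bigr => j _.
  by rewrite !mxE mulrC -[in LHS]Wsym mxE.
apply: Wlam; under eq_bigr => i _ do rewrite mxE.
by rewrite -summxE z0 mxE.
Qed.

End mixing_spread.

(** * Convexity and smoothness *)

Section convex_sets.
Variables (R : realType) (d : nat) (Om : set 'rV[R]_d).
Hypothesis cOm : convex_setv Om.

Lemma convex_setv_sum (m : nat) (w : 'I_m -> R) (x : 'I_m -> 'rV[R]_d) :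
  (forall i, 0 <= w i) -> \sum_i w i = 1 -> (forall i, Om (x i)) ->
  Om (\sum_i w i *: x i).
Proof.
move=> w0 w1 Ox.
(* Partial sums of the weights need not be one, so the induction normalizes them; the left
   alternative covers a zero total, where no normalization exists. *)
have : \sum_i w i = 0 \/
    0 < \sum_i w i /\ Om ((\sum_i w i)^-1 *: \sum_i w i *: x i).
  elim: (index_enum 'I_m) => [|i r IH]; first by left; rewrite big_nil.
  rewrite !big_cons; set S := \sum_(j <- r) w j in IH *.
  set X := \sum_(j <- r) _ in IH *.
  have S0 : 0 <= S by apply: sumr_ge0.
  have [wi0|wi0] := eqVneq (w i) 0; first by rewrite wi0 scale0r !add0r.
  have wi : 0 < w i by rewrite lt_neqAle eq_sym wi0 w0.
  right; split; first by rewrite ltr_pwDl.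
  have wS : w i + S != 0 by rewrite gt_eqF // ltr_pwDl.
  case: IH => [S00|[Sp OX]].
    have X0 : X = 0.
      rewrite /X big_seq big1 // => j jr; move/eqP: S00; rewrite /S.
      rewrite psumr_eq0 // => /allP /(_ j jr) /eqP ->; exact: scale0r.
    by rewrite S00 X0 !addr0 scalerA mulVf ?scale1r.
  have -> : (w i + S)^-1 *: (w i *: x i + X) =
      (1 - S / (w i + S)) *: x i + (S / (w i + S)) *: (S^-1 *: X).
    rewrite scalerDr !scalerA; congr (_ *: _ + _ *: _).
      by field.
    by field; rewrite wS gt_eqF.
  apply: cOm => //; rewrite divr_ge0 ?(ltW Sp) ?addr_ge0 ?w0 //=.
  by rewrite ler_pdivrMr ?mul1r ?ltr_pwDl // lerDr w0.
by rewrite w1 => -[/eqP|[_]]; rewrite ?oner_eq0 // invr1 scale1r.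
Qed.

Lemma convex_setv_avg (m : nat) (x : 'I_m -> 'rV[R]_d) : (0 < m)%N ->
  (forall i, Om (x i)) -> Om (avg x).
Proof.
move=> m0 Ox; rewrite /avg scaler_sumr.
apply: (convex_setv_sum (w := fun=> m%:R^-1)) => //.
by rewrite sumr_const card_ord -[_ *+ m]mulr_natr mulVf // pnatr_eq0 -lt0n.
Qed.

Lemma convex_setv_segment (x y : 'rV[R]_d) (t : R) : Om x -> Om y ->
  0 <= t <= 1 -> Om (x + t *: (y - x)).
Proof.
move=> Ox Oy t01; rewrite (_ : x + _ = (1 - t) *: x + t *: y); first exact: cOm.
by rewrite scalerBr scalerBl scale1r addrAC addrA.
Qed.

End convex_sets.

(** * First-order estimates for smooth and convex functions *)

Section calculus.
Variables (R : realType) (d : nat).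
Implicit Types (f : 'rV[R]_d -> R) (x y v : 'rV[R]_d) (Om : set 'rV[R]_d).

Lemma derive_dotv f x v : differentiable f x -> 'D_v f x = dotv (grad f x) v.
Proof.
move=> df; rewrite deriveE // {1}(row_sum_delta v) linear_sum.
by apply: eq_bigr => l _; rewrite linearZ /= mxE deriveE // mulrC.
Qed.

Lemma mean_value f x y :
  (forall t : R, 0 <= t <= 1 -> differentiable f (x + t *: (y - x))) ->
  exists2 t : R, 0 <= t <= 1 &
    f y - f x = dotv (grad f (x + t *: (y - x))) (y - x).
Proof.
move=> df; set v := y - x; pose phi (t : R) := f (x + t *: v).
have quotE (t : R) : (fun h : R => h^-1 *: ((phi \o shift t) (h *: 1) - phi t)) =
    (fun h : R => h^-1 *: ((f \o shift (x + t *: v)) (h *: v) - f (x + t *: v))).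
  apply/funext => h; rewrite /phi /=; congr (_ *: (f _ - _)).
  by rewrite [h *: 1]mulr1 scalerDl addrCA.
have dphi (t : R) : 0 <= t <= 1 ->
    is_derive t (1 : R) phi (dotv (grad f (x + t *: v)) v).
  move=> t01; have dft := df _ t01; split.
    by rewrite /derivable quotE; exact: diff_derivable.
  by rewrite -derive_dotv // /derive quotE.
have in01 (t : R) : t \in `]0, 1[%R -> 0 <= t <= (1 : R).
  by rewrite in_itv /= => /andP[/ltW -> /ltW ->].
have cphi : {within `[(0:R), 1], continuous phi}.
  apply: derivable_within_continuous => t; rewrite in_itv /= => t01.
  by have [] := dphi t t01.
have [t] := MVT (@ltr01 R) (fun t tI => dphi t (in01 t tI)) cphi.
move=> /in01 t01; rewrite subr0 mulr1 /phi scale1r scale0r addr0 => E.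
by exists t => //; rewrite -E /v (addrC x) subrK.
Qed.

(** The constant is [L] and not the sharp [L / 2]: this is what the mean value theorem gives
    directly, and it is enough for an order of magnitude. *)
Definition quad_approx Om (L : R) f :=
  forall x y, Om x -> Om y ->
    `|f y - f x - dotv (grad f x) (y - x)| <= L * enorm (y - x) ^+ 2.

Definition grad_lipschitz Om (L : R) f :=
  forall x y, Om x -> Om y -> enorm (grad f x - grad f y) <= L * enorm (x - y).

(** The absolute value makes the constant nonnegative, since no sign is assumed for [L]. *)
Lemma smooth_near_lipschitz Om (L : R) f :
  smooth_near Om L f -> grad_lipschitz Om `|L| f.
Proof.
move=> [U [_ [OU [_ lip]]]] x y /OU Ux /OU Uy; apply: le_trans (lip x y Ux Uy) _.
by rewrite ler_wpM2r ?enorm_ge0 // ler_norm.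
Qed.

Lemma smooth_near_differentiable Om (L : R) f x :
  smooth_near Om L f -> Om x -> differentiable f x.
Proof. by move=> [U [_ [OU [df _]]]] /OU; exact: df. Qed.

Lemma smooth_near_quad Om (L : R) f :
  convex_setv Om -> smooth_near Om L f -> quad_approx Om `|L| f.
Proof.
move=> cOm sf x y Ox Oy.
have seg (t : R) : 0 <= t <= 1 -> Om (x + t *: (y - x)) by exact: convex_setv_segment.
have [t t01 ->] := mean_value (fun t t01 => smooth_near_differentiable sf (seg t t01)).
rewrite -dotvBl; apply: le_trans (ler_norm_dotv _ _) _.
rewrite expr2 mulrA ler_wpM2r ?enorm_ge0 //.
apply: le_trans (smooth_near_lipschitz sf (seg t t01) Ox) _.
rewrite ler_wpM2l // addrC addKr enormZ ler_piMl ?enorm_ge0 //.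
by case/andP: t01 => t0 t1; rewrite ger0_norm.
Qed.

(** Convexity at [x + t (y - x)] and the quadratic estimate at the same point give, after division
    by [t], the inequality up to an error [t * (L * e)]; a small [t] then excludes a strict
    violation. *)
Lemma convex_grad Om (L : R) f x y : convex_setv Om -> convex_fun_on Om f ->
  quad_approx Om L f -> Om x -> Om y -> dotv (grad f x) (y - x) <= f y - f x.
Proof.
move=> cOm cf qf Ox Oy; set a := dotv _ _; set b := f y - f x.
set e := enorm (y - x) ^+ 2.
have main (t : R) : 0 < t <= 1 -> a <= b + t * (L * e).
  move=> /andP[t0 t1]; have t01 : 0 <= t <= 1 by rewrite ltW.
  have Oz := convex_setv_segment cOm Ox Oy t01.
  have := qf x _ Ox Oz; rewrite [x + _ - x]addrC addKr => /ler_normlP [].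
  rewrite dotvZr enormZ exprMn real_normK ?num_real // -/e -/a => + _.
  have := cf x y Ox Oy t t01.
  rewrite (_ : (1 - t) *: x + t *: y = x + t *: (y - x)); last first.
    by rewrite scalerBr scalerBl scale1r addrAC addrA.
  set z := f (x + _) => h1 h2.
  rewrite -(ler_pM2l t0) /b. lra.
rewrite leNgt; apply/negP => ba.
have e0 : 0 <= `|L * e| by [].
(* Chosen so that [t] is at most 1 and [t * (L * e) < a - b], which contradicts [main]. *)
pose t := (a - b) / (a - b + 1 + `|L * e|).
have den : 0 < a - b + 1 + `|L * e| by lra.
have t01 : 0 < t <= 1.
  by rewrite divr_gt0 ?subr_gt0 //= ler_pdivrMr // mul1r; lra.
have := main t t01; have := ler_norm (L * e).
have : t * (a - b + 1 + `|L * e|) = a - b by rewrite divfK // gt_eqF.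
nra.
Qed.

End calculus.

(** * Smoothness of the averaged local functions *)

Section local_functions.
Variables (R : realType) (d m : nat) (n : 'I_m -> nat).
Variables (fij : forall i : 'I_m, 'I_(n i) -> 'rV[R]_d -> R).
Variables (Om : set 'rV[R]_d) (L : R).
Hypotheses (cOm : convex_setv Om) (n0 : forall i, (0 < n i)%N).
Hypothesis sf : forall i j, smooth_near Om L (@fij i j).

Lemma grad_floc i x : Om x -> grad (floc fij i) x = avg (fun j => grad (@fij i j) x).
Proof.
move=> Ox; apply/rowP => l; rewrite !mxE summxE.
have dv j : derivable (@fij i j) x (delta_mx 0 l).
  exact/diff_derivable/(smooth_near_differentiable (sf j) Ox).
have -> : floc fij i = (n i)%:R^-1 \*: (\sum_(j < n i) @fij i j).
  by apply/funext => z; rewrite /floc /= fct_sumE.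
rewrite deriveZ ?derive_sum //; last exact: derivable_sum.
by congr (_ * _); apply: eq_bigr => j _; rewrite mxE.
Qed.

Lemma grad_floc_lipschitz i : grad_lipschitz Om `|L| (floc fij i).
Proof.
move=> x y Ox Oy; rewrite !grad_floc // -avgB; apply: avg_le => // j.
exact: (smooth_near_lipschitz (sf j)).
Qed.

Lemma floc_quad i : quad_approx Om `|L| (floc fij i).
Proof.
move=> x y Ox Oy; rewrite grad_floc // /floc /avg dotvZl dotv_suml -!mulrBr -!sumrB.
rewrite normrM ger0_norm ?invr_ge0 // mulrC ler_pdivrMr ?ltr0n //.
apply: le_trans (ler_norm_sum _ _ _) _.
apply: le_trans (ler_sum _ (fun j _ => smooth_near_quad cOm (sf j) Ox Oy)) _.
by rewrite sumr_const card_ord mulr_natr.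
Qed.

End local_functions.

(** * The algorithm *)

(** The comparison sequence is [A / (k + K)]. Since [lam = 1 - 2 / K], the shift [K] keeps the ratio
    of consecutive terms above [lam] from the first index on, and the slack absorbs [c / k]. The
    sequence is deterministic, so it can serve as a bound along every sample path. *)
Lemma contraction_recursion (R : realType) (lam c a : R) :
  0 <= lam < 1 -> 0 <= c -> 0 <= a ->
  exists (A : R) (b : nat -> R), [/\ 0 <= A, a <= b 1%N,
    forall k, (0 < k)%N -> lam * b k + c / k%:R <= b k.+1 &
    forall k, (0 < k)%N -> b k <= A / k%:R].
Proof.
move=> /andP[lam0 lam1] c0 a0; pose K := 2 / (1 - lam).
have lamK : lam * K = K - 2 by rewrite /K; field; rewrite subr_eq0 gt_eqF.
have K2 : 2 <= K by rewrite ler_pdivlMr ?subr_gt0 //; nra.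
clearbody K.
(* The first summand gives [a <= b 1], the second [c * (K + 2) <= A / K], which is what the
   inductive step needs. *)
pose A := a * (1 + K) + c * K * (K + 2).
have A0 : 0 <= A by rewrite /A; nra.
exists A, (fun k => A / (k%:R + K)); split=> // [|k k0|k k0].
- rewrite ler_pdivlMr; last by nra.
  have : 0 <= c * K * (K + 2) by nra.
  by rewrite /A; nra.
- have k1 : (1 : R) <= k%:R by rewrite ler1n.
  rewrite -natr1; set x := k%:R in k1 *.
  have xK : 0 < x + K by lra.
  have -> : lam * (A / (x + K)) = A * (K - 2) / (K * (x + K)).
    by rewrite -lamK; field; rewrite !gt_eqF //; lra.
  have xK1 : 0 < x + 1 + K by lra.
  rewrite ler_pdivlMr // mulrDl.
  have h1 : A * (K - 2) / (K * (x + K)) * (x + 1 + K) <= A - A / K.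
    have -> : A - A / K = A * (K - 1) * (x + K) / (K * (x + K)).
      by field; rewrite !gt_eqF //; lra.
    have K0 : 0 < K by lra.
    have KxK : 0 < K * (x + K) by exact: mulr_gt0.
    rewrite mulrAC ler_pM2r ?invr_gt0 //.
    by rewrite -!mulrA ler_wpM2l //; nra.
  have h2 : c / x * (x + 1 + K) <= c * (K + 2).
    rewrite mulrAC ler_pdivrMr; last lra.
    by rewrite -mulrA ler_wpM2l //; nra.
  have h3 : c * (K + 2) <= A / K.
    rewrite ler_pdivlMr; last lra.
    have : 0 <= a * (1 + K) by nra.
    by rewrite /A; nra.
  by apply: le_trans (lerD h1 (le_trans h2 h3)) _; rewrite subrK.
- have k1 : (1 : R) <= k%:R by rewrite ler1n.
  by rewrite ler_wpM2l // lef_pV2 ?posrE; lra.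
Qed.

(** * Expectations over the sampling *)

Section expectation.
Variables (R : realType) (d m : nat) (n : 'I_m -> nat).
Variables (fij : forall i : 'I_m, 'I_(n i) -> 'rV[R]_d -> R) (W : 'M[R]_m).
Variables (lmo : nat -> 'I_m -> 'rV[R]_d -> 'rV[R]_d) (q : nat) (gam : nat -> R).
Variables (s : nat -> nat).
Hypothesis n0 : forall i, (0 < n i)%N.

Lemma card_Samp_gt0 sz : (0 < #|{: Samp n sz}|)%N.
Proof.
by apply/card_gt0P; exists [ffun i => [ffun=> Ordinal (n0 i)]].
Qed.

(** An invariant preserved by every sampling outcome bounds [g] on all paths, and an average of
    numbers within [e] of [a] is within [e] of [a]. The set of outcomes is nonempty, so the weights
    do sum to one. *)
Lemma expect_from_dist (P : nat -> state R d m -> Prop) (g : state R d m -> R)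
    (a e : R) (r k : nat) (st : state R d m) :
  (forall k st (S : Samp n (s k)), (0 < k)%N -> P k st ->
     P k.+1 (dstep fij W lmo q gam st S)) ->
  (forall st, P (r + k)%N st -> `|g st - a| <= e) ->
  (0 < k)%N -> P k st -> `|expect_from fij W lmo q gam s r k g st - a| <= e.
Proof.
move=> step; elim: r k st => [|r IH] k st ge k0 Pk /=; first exact: ge.
set N := #|_|%:R; have N0 : 0 < N :> R by rewrite ltr0n card_Samp_gt0.
pose f (S : Samp n (s k)) :=
  expect_from fij W lmo q gam s r k.+1 g (dstep fij W lmo q gam st S).
have -> : N^-1 * (\sum_(S : Samp n (s k)) f S) - a = N^-1 * \sum_S (f S - a).
  rewrite sumrB mulrBr sumr_const -/N -[a *+ _]mulr_natl -/N.
  by rewrite mulKf // gt_eqF.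
rewrite normrM ger0_norm ?invr_ge0 ?(ltW N0) // mulrC ler_pdivrMr //.
apply: le_trans (ler_norm_sum _ _ _) _.
have fe S : `|f S - a| <= e.
  apply: IH => //; last exact: step.
  by move=> st'; rewrite addnS -addSn; exact: ge.
apply: le_trans (ler_sum _ (fun S _ => fe S)) _.
by rewrite sumr_const -mulr_natr.
Qed.

End expectation.

Section scalar_average.
Variables (R : realType) (d m : nat).

Lemma mean_le (h : 'I_m -> R) (c : R) : (0 < m)%N -> (forall i, h i <= c) ->
  m%:R^-1 * \sum_i h i <= c.
Proof.
move=> m0 hc; rewrite mulrC ler_pdivrMr ?ltr0n //.
by apply: le_trans (ler_sum _ (fun i _ => hc i)) _; rewrite sumr_const card_ord mulr_natr.
Qed.

Lemma dotv_avgl (x : 'I_m -> 'rV[R]_d) v :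
  dotv (avg x) v = m%:R^-1 * \sum_i dotv (x i) v.
Proof. by rewrite dotvZl dotv_suml. Qed.

Lemma dotv_avgr (x : 'I_m -> 'rV[R]_d) v :
  dotv v (avg x) = m%:R^-1 * \sum_i dotv v (x i).
Proof. by rewrite dotvZr dotv_sumr. Qed.

End scalar_average.

(** * Estimates for one iteration *)

Section one_iteration.
Variables (R : realType) (d m : nat) (n : 'I_m -> nat).
Variables (fij : forall i : 'I_m, 'I_(n i) -> 'rV[R]_d -> R).
Variables (Om : set 'rV[R]_d) (L : R) (adj : rel 'I_m) (W : 'M[R]_m).
Variables (q : nat) (s : nat -> nat).
Variables (lmo : nat -> 'I_m -> 'rV[R]_d -> 'rV[R]_d) (M lam : R).
Hypotheses (m0 : (0 < m)%N) (n0 : forall i, (0 < n i)%N).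
Hypotheses (cOm : convex_setv Om) (OmM : forall x, Om x -> enorm x <= M).
Hypothesis sf : forall i j, smooth_near Om L (@fij i j).
Hypothesis Wmix : mixing adj W.
Hypothesis lam0 : 0 <= lam.
Hypothesis Wlam : forall x : 'I_m -> 'rV[R]_d, spread (mix W x) <= lam * spread x.
Hypothesis lmoP : forall k i dv, lmo_spec Om dv (lmo k i dv).
Hypothesis s0 : forall k, (0 < s k)%N.

Local Notation f := (floc fij).
Local Notation gam := (fun k : nat => 2 / k.+1%:R : R).

Lemma step_size_bounds k : (0 < k)%N -> 0 <= gam k <= 1 /\ gam k <= 2 / k%:R.
Proof.
move=> k0; split; last first.
  by rewrite ler_pM2l ?ltr0n // lef_pV2 ?posrE ?ltr0n // ler_nat.
by rewrite divr_ge0 //= ler_pdivrMr ?ltr0n // mul1r ler_nat.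
Qed.

Section step.
Variables (k : nat) (st : state R d m) (S : Samp n (s k)).
Hypotheses (k0 : (0 < k)%N) (Ox : forall i, Om (sx st i)).

Local Notation st' := (@dstep R d m n fij W lmo q gam s k st S).
Local Notation u := (fun i => lmo k i (sd st i)).

Let gam01 := (step_size_bounds k0).1.
Let gam_le := (step_size_bounds k0).2.
Let Ou i : Om (u i). Proof. by case: (lmoP k i (sd st i)). Qed.
Let M0 : 0 <= M.
Proof. exact: le_trans (enorm_ge0 _) (OmM (Ox (Ordinal m0))). Qed.

Lemma sx_step i : sx st' i = (1 - gam k) *: mix W (sx st) i + gam k *: u i.
Proof. by []. Qed.

Lemma sd_step : sd st' = mix W (fun i => sd st i + sv st' i - sv st i).
Proof. by []. Qed.

Lemma sx_step_in i : Om (sx st' i).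
Proof.
rewrite sx_step; apply: cOm => //.
case: Wmix => _ [_ [_ [W0 [_ [Wrow _]]]]].
exact: convex_setv_sum.
Qed.

(** Mixing preserves averages, so the average iterate makes a plain Frank-Wolfe step towards the
    averaged oracle point. *)
Lemma avg_sx_step : avg (sx st') = avg (sx st) + gam k *: (avg u - avg (sx st)).
Proof.
rewrite (_ : sx st' = fun i => (1 - gam k) *: mix W (sx st) i + gam k *: u i) //.
rewrite avgD !avgZ (avg_mix Wmix) scalerBr scalerBl scale1r addrAC -addrA.
by rewrite (addrC (gam k *: _)).
Qed.

Lemma spread_sx_step :
  spread (sx st') <= lam * spread (sx st) + 4 * m%:R * M / k%:R.
Proof.
have /andP[g0 g1] := gam01.
apply: le_trans (spreadD _ _) _; rewrite !spreadZ !ger0_norm ?subr_ge0 //.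
apply: lerD.
  apply: le_trans (Wlam _); apply: ler_piMl; first exact: spread_ge0.
  by rewrite gerBl.
have su : spread u <= m%:R * (2 * M) by apply: spread_le => // i; exact: OmM.
apply: le_trans (ler_pM g0 (spread_ge0 _) gam_le su) _.
by rewrite le_eqVlt; apply/orP; left; apply/eqP; ring.
Qed.

Lemma avg_sx_step_dist : enorm (avg (sx st') - avg (sx st)) <= 4 * M / k%:R.
Proof.
have /andP[g0 g1] := gam01.
rewrite avg_sx_step addrC addKr enormZ ger0_norm //.
have ud : enorm (avg u - avg (sx st)) <= 2 * M.
  rewrite mulr_natl mulr2n; apply: le_trans (ler_enormB _ _) _.
  by apply: lerD; apply: avg_le => // i; exact: OmM.
apply: le_trans (ler_pM g0 (enorm_ge0 _) gam_le ud) _.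
by rewrite le_eqVlt; apply/orP; left; apply/eqP; ring.
Qed.

Lemma sx_step_dist i : enorm (sx st' i - sx st i) <=
  spread (sx st') + spread (sx st) + 4 * M / k%:R.
Proof.
apply: le_trans (ler_dist_enormD (avg (sx st')) _ _) _.
rewrite -[leRHS]addrA; apply: lerD; first exact: (spread_enorm (sx st')).
apply: le_trans (ler_dist_enormD (avg (sx st)) _ _) _.
rewrite [leLHS]addrC; apply: lerD; last exact: avg_sx_step_dist.
by rewrite enormBC (spread_enorm (sx st)).
Qed.

Lemma sv_step_checkpoint i : (k.+1 %% q == 0)%N -> sv st' i = grad (f i) (sx st' i).
Proof.
move=> kq; rewrite (grad_floc sf); last exact: sx_step_in.
by rewrite /sv /dstep /= kq.
Qed.

Lemma sv_step_sample i : (k.+1 %% q != 0)%N ->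
  enorm (sv st' i - sv st i) <= `|L| * enorm (sx st' i - sx st i).
Proof.
move=> kq; have -> : sv st' i - sv st i = avg (fun p : 'I_(s k) =>
    grad (fij (S i p)) (sx st' i) - grad (fij (S i p)) (sx st i)).
  by rewrite {1}/sv /dstep /= (negbTE kq) addrK.
apply: avg_le => // p; apply: (smooth_near_lipschitz (sf _)) => //.
exact: sx_step_in.
Qed.

Lemma grad_step_dist i : enorm (grad (f i) (sx st' i) - grad (f i) (sx st i)) <=
  `|L| * enorm (sx st' i - sx st i).
Proof. by apply: (grad_floc_lipschitz n0 sf) => //; exact: sx_step_in. Qed.

(** Covers both kinds of update: a reset also removes the error accumulated so far, hence the second
    term. *)
Lemma sv_step_dist i : enorm (sv st' i - sv st i) <=
  `|L| * enorm (sx st' i - sx st i) + enorm (sv st i - grad (f i) (sx st i)).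
Proof.
have [kq|kq] := boolP (k.+1 %% q == 0)%N; last first.
  by apply: le_trans (sv_step_sample i kq) _; rewrite lerDl enorm_ge0.
rewrite sv_step_checkpoint //.
apply: le_trans (ler_dist_enormD (grad (f i) (sx st i)) _ _) _.
by apply: lerD; [exact: grad_step_dist|rewrite enormBC].
Qed.

Lemma sv_step_error i : (k.+1 %% q != 0)%N ->
  enorm (sv st' i - grad (f i) (sx st' i)) <=
  enorm (sv st i - grad (f i) (sx st i)) + 2 * (`|L| * enorm (sx st' i - sx st i)).
Proof.
move=> kq.
have -> : sv st' i - grad (f i) (sx st' i) = (sv st i - grad (f i) (sx st i)) +
    ((sv st' i - sv st i) - (grad (f i) (sx st' i) - grad (f i) (sx st i))).
  by apply/rowP => l; rewrite !mxE; ring.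
apply: le_trans (ler_enormD _ _) _; rewrite lerD2l mulr_natl mulr2n.
apply: le_trans (ler_enormB _ _) _.
by apply: lerD; [exact: sv_step_sample|exact: grad_step_dist].
Qed.

(** The gradient-tracking invariant: adding the increments of [v] and mixing keep the two averages
    equal. *)
Lemma avg_sd_step : avg (sd st) = avg (sv st) -> avg (sd st') = avg (sv st').
Proof.
move=> dv; rewrite sd_step (avg_mix Wmix) avgB avgD dv.
by rewrite [avg (sv st) + _]addrC addrK.
Qed.

Lemma spread_sd_step (c : R) : 0 <= c ->
  (forall i, enorm (sv st' i - sv st i) <= c) ->
  spread (sd st') <= lam * spread (sd st) + lam * (m%:R * (2 * c)).
Proof.
move=> c0 vc; rewrite sd_step; apply: le_trans (Wlam _) _.
rewrite -mulrDr ler_wpM2l //.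
rewrite (_ : (fun i => _) = fun i => sd st i + (sv st' i - sv st i)); last first.
  by apply/funext => i; rewrite addrA.
by apply: le_trans (spreadD _ _) _; rewrite lerD2l; exact: spread_le.
Qed.

(* Frank-Wolfe descent: each [u i] minimizes [<., d_i>], and [d_i] is within
   [e] of the gradient of [F] at the average. *)
Lemma Fglob_step (xstar : 'rV[R]_d) (e : R) :
  (forall i, convex_fun_on Om (f i)) -> Om xstar ->
  avg (sd st) = avg (sv st) ->
  (forall i, enorm (sv st i - grad (f i) (sx st i)) <= e) ->
  Fglob fij (xbar st') - Fglob fij xstar <=
    (1 - gam k) * (Fglob fij (xbar st) - Fglob fij xstar)
    + 2 / k%:R * (4 * M * (`|L| * spread (sx st) + e + spread (sd st)))
    + `|L| * (4 * M / k%:R) ^+ 2.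
Proof.
move=> cf Oxs dv ve; have /andP[g0 g1] := gam01.
set X := avg (sx st); rewrite -[xbar st']/(avg (sx st')) -[xbar st]/X.
have OX : Om X by exact: convex_setv_avg.
have OX' : Om (avg (sx st')) by apply: convex_setv_avg => // i; exact: sx_step_in.
pose g := avg (fun i => grad (f i) X).
have avg_quad : Fglob fij (avg (sx st')) - Fglob fij X - dotv g (avg (sx st') - X)
    <= `|L| * (4 * M / k%:R) ^+ 2.
  rewrite /g dotv_avgl -!mulrBr -!sumrB; apply: mean_le => // i.
  apply: le_trans (ler_norm _) (le_trans (floc_quad cOm n0 sf i OX OX') _).
  rewrite ler_wpM2l // ler_pXn2r ?nnegrE ?enorm_ge0 ?avg_sx_step_dist //.
  by rewrite divr_ge0 // mulr_ge0.
(* The path runs from [sd st i] to the average of the [d_j], which equals that of the [v_j], then to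
   the gradients at the [x_j], then by smoothness to those at [X]. *)
have err i : enorm (g - sd st i) <= `|L| * spread (sx st) + e + spread (sd st).
  apply: le_trans (ler_dist_enormD (avg (sd st)) _ _) _.
  apply: lerD; last by rewrite enormBC (spread_enorm (sd st)).
  rewrite dv /g -avgB; apply: avg_le => // j.
  apply: le_trans (ler_dist_enormD (grad (f j) (sx st j)) _ _) _.
  apply: lerD; last by rewrite enormBC.
  apply: le_trans (grad_floc_lipschitz n0 sf _ OX (Ox j)) _.
  by rewrite ler_wpM2l // enormBC (spread_enorm (sx st)).
set E := `|L| * spread (sx st) + e + spread (sd st) in err *.
have E0 : 0 <= E by apply: le_trans (enorm_ge0 _) (err (Ordinal m0)).
have dist2M x y : Om x -> Om y -> enorm (x - y) <= 2 * M.
  move=> ? ?; apply: le_trans (ler_enormB _ _) _.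
  by rewrite mulr_natl mulr2n lerD // OmM.
(* The oracle compares [u i] with [xstar] along [d_i]; exchanging [d_i] for [g] on [u i - X] and on
   [X - xstar] costs [2 * M * E] each. *)
have lin i : dotv g (u i - X) <= dotv g (xstar - X) + 4 * M * E.
  have pert v w : Om v -> Om w -> dotv (g - sd st i) (v - w) <= 2 * M * E.
    move=> Ov Ow; apply: le_trans (dotv_le _ _) _.
    by rewrite mulrC ler_pM ?enorm_ge0 ?dist2M.
  have [_ /(_ _ Oxs)] := lmoP k i (sd st i).
  have := pert _ _ (Ou i) OX; have := pert _ _ OX Oxs.
  rewrite !dotvBl !dotvBr !(dotvC (sd st i)); lra.
have slope : dotv g (xstar - X) <= Fglob fij xstar - Fglob fij X.
  rewrite /g dotv_avgl -mulrBr -sumrB ler_wpM2l ?invr_ge0 //.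
  by apply: ler_sum => i _; apply: (convex_grad cOm (cf i) (floc_quad cOm n0 sf i)).
have descent : dotv g (avg (sx st') - X) <=
    gam k * (Fglob fij xstar - Fglob fij X + 4 * M * E).
  rewrite avg_sx_step addrC addKr dotvZr ler_wpM2l // -(avgBc m0) dotv_avgr.
  by apply: mean_le => // i; apply: le_trans (lin i) _; rewrite lerD2r.
have noise : gam k * (4 * M * E) <= 2 / k%:R * (4 * M * E).
  by apply: ler_wpM2r; [rewrite !mulr_ge0|exact: gam_le].
move: avg_quad descent noise; rewrite /=; set a := 2 / k.+1%:R; set F' := Fglob _ _.
set D := dotv _ _; set b := 2 / k%:R * _; set c := `|L| * _.
lra.
Qed.

End step.

End one_iteration.

(** * Closing recursions and the rate *)

Lemma compact_enorm_bounded (R : realType) (d : nat) (Om : set 'rV[R]_d) :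
  compact Om -> exists M : R, forall x, Om x -> enorm x <= M.
Proof.
move=> /compact_bounded[N [_ /(_ (`|N| + 1))]].
have NN : N < `|N| + 1 by rewrite ltr_pwDr // ler_norm.
move=> /(_ NN) OmN; exists (#|'I_d|%:R * (`|N| + 1)) => x Ox.
rewrite enormE; apply: le_trans (l2_const _ _); last by rewrite addr_ge0.
rewrite /l2 ler_sqrt ?sum_sqr_ge0 //; apply: ler_sum => l _.
rewrite -(real_normK (num_real (x 0 l))) ler_pXn2r ?nnegrE ?addr_ge0 //.
apply: le_trans (OmN x Ox); rewrite [leRHS]/Num.norm /= mx_normrE.
exact: (le_bigmax _ (fun ij => `|x ij.1 ij.2|) (0, l)).
Qed.

(** The factor 4 is one 2 for [4 ^+ r + 1 <= 2 * 4 ^+ r] and one for [k + 1 <= 2 * k], which pays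
    for the smaller bound at the next index. *)
Lemma epoch_error_growth (R : realType) (c e : R) (r k : nat) : (0 < k)%N ->
  0 <= c -> e <= c * 4 ^+ r / k%:R -> e + c / k%:R <= c * 4 ^+ r.+1 / k.+1%:R.
Proof.
move=> k0 c0 ek; have k1 : (1 : R) <= k%:R by rewrite ler1n.
have r1 : (1 : R) <= 4 ^+ r by rewrite exprn_ege1 // ler1n.
apply: le_trans (_ : c * (4 ^+ r + 1) / k%:R <= _).
  by rewrite mulrDr mulr1 mulrDl lerD2r.
rewrite ler_pdivrMr; last lra.
rewrite mulrAC ler_pdivlMr ?ltr0n // -[k.+1%:R]natr1 exprS -!mulrA ler_wpM2l //.
move: (k%:R) (4 ^+ r) k1 r1 => x y x1 y1.
have : 0 <= (x - 1) * (y - 1) by rewrite mulr_ge0 // subr_ge0.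
lra.
Qed.

(** The contraction leaves a slack of [c / (k (k + 1))], which exceeds [B / k^2] because
    [B (k + 1) <= 2 B k <= c k]. *)
Lemma frank_wolfe_recursion (R : realType) (h c B : R) (k : nat) : (0 < k)%N ->
  0 <= B -> 2 * B <= c -> h <= c / k%:R ->
  (1 - 2 / k.+1%:R) * h + B / k%:R ^+ 2 <= c / k.+1%:R.
Proof.
move=> k0 B0 Bc hk; rewrite -[k.+1%:R]natr1.
have k1 : (1 : R) <= k%:R by rewrite ler1n.
move: (k%:R) k1 hk => x x1 hx.
have w0 : 0 <= 1 - 2 / (x + 1).
  by rewrite subr_ge0 ler_pdivrMr ?mul1r; lra.
apply: le_trans (lerD (ler_wpM2l w0 hx) (lexx _)) _.
rewrite -subr_ge0.
have -> : c / (x + 1) - ((1 - 2 / (x + 1)) * (c / x) + B / x ^+ 2) =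
    (c * x - B * (x + 1)) / ((x + 1) * x ^+ 2).
  by field; rewrite !gt_eqF //; lra.
by rewrite divr_ge0 ?mulr_ge0 ?sqr_ge0 //; nra.
Qed.

Theorem theorem2 (R : realType) (d m : nat) (n : 'I_m -> nat)
  (fij : forall i : 'I_m, 'I_(n i) -> 'rV[R]_d -> R)
  (Om : set 'rV[R]_d) (L G C : R) (adj : rel 'I_m) (W : 'M[R]_m)
  (q : nat) (s : nat -> nat) (lmo : nat -> 'I_m -> 'rV[R]_d -> 'rV[R]_d)
  (x1 : 'I_m -> 'rV[R]_d) (xstar : 'rV[R]_d) :
  (0 < m)%N -> (forall i, 0 < n i)%N ->
  (* Assumption 1 *)
  Om !=set0 -> convex_setv Om -> compact Om ->
  (* standing regularity *)
  (forall i j, smooth_near Om L (fij i j)) ->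
  (forall i, lipschitz_on_set Om G (floc fij i)) ->
  (forall i x, Om x -> enorm (grad (floc fij i) x) <= C) ->
  (* Assumption 2 *)
  mixing adj W -> lambda2_lt1 W ->
  (* convexity of the local functions *)
  (forall i, convex_fun_on Om (floc fij i)) ->
  (* algorithm data: linear minimization oracle, initial points, epoch length,
     sample sizes satisfying Sampling Rule 1 with gamma_k = 2/(k+1) *)
  (forall k i dv, lmo_spec Om dv (lmo k i dv)) ->
  (forall i, Om (x1 i)) ->
  (0 < q)%N -> (forall k, 0 < s k)%N ->
  sampling_rule1 q s (fun k => (2 / (k.+1)%:R : R)) ->
  (* x* optimal *)
  Om xstar -> (forall x, Om x -> Fglob fij xstar <= Fglob fij x) ->
  exists (c : R) (K0 : nat), forall k : nat, (K0 <= k)%N ->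
    `| expect_at fij W lmo q (fun k => (2 / (k.+1)%:R : R)) s x1 k
         (fun st => Fglob fij (xbar st)) - Fglob fij xstar | <= c / k%:R.
Proof.
move=> m0 n0 _ cOm /compact_enorm_bounded[M OmM] sf _ _ Wmix Wgap cf lmoP Ox1 q0 s0 _.
move=> Oxs xsmin.
have [lam lam01 Wlam] := mixing_spread m0 Wmix Wgap.
have /andP[lam0 _] := lam01.
have M0 : 0 <= M := le_trans (enorm_ge0 _) (OmM _ Oxs).
have L0 : 0 <= `|L| by [].
pose gam k : R := 2 / k.+1%:R.
pose st1 := init_state fij x1.
have cx0 : 0 <= 4 * m%:R * M by rewrite !mulr_ge0.
have [A1 [b1 [A10 b1_init b1_step b1_le]]] :=
  contraction_recursion lam01 cx0 (spread_ge0 (sx st1)).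
(* [D / k] bounds the move of each [x_i]: two deviations from the average and the move of the
   average itself. *)
pose D := 2 * A1 + 4 * M; have D0 : 0 <= D by rewrite /D; lra.
have LD0 : 0 <= `|L| * D by exact: mulr_ge0.
pose cs := 2 * (`|L| * D); have cs0 : 0 <= cs by rewrite /cs; lra.
pose cv := cs * 4 ^+ q; have cv0 : 0 <= cv by rewrite mulr_ge0 // exprn_ge0.
have cv_le k : cs * 4 ^+ (k %% q) / k%:R <= cv / k%:R.
  rewrite ler_wpM2r ?invr_ge0 // ler_wpM2l // ler_weXn2l ?ler1n //.
  by rewrite ltnW // ltn_mod.
(* [Dv / k] bounds the change of each [v_i], resets included; it drives the recursion for the spread
   of the [d_i]. *)
pose Dv := `|L| * D + cv; have Dv0 : 0 <= Dv by rewrite addr_ge0.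
have cd0 : 0 <= lam * (m%:R * (2 * Dv)) by rewrite !mulr_ge0.
have [A2 [b2 [A20 b2_init b2_step b2_le]]] :=
  contraction_recursion lam01 cd0 (spread_ge0 (sd st1)).
pose E := `|L| * A1 + cv + A2.
have E0 : 0 <= E by rewrite !addr_ge0 // mulr_ge0.
(* Collects both error terms of [Fglob_step] once [E / k] bounds the gradient error. *)
pose B := 8 * M * E + 16 * (`|L| * M ^+ 2).
have B0 : 0 <= B by rewrite addr_ge0 ?mulr_ge0 ?sqr_ge0.
pose gap (st : state R d m) := Fglob fij (xbar st) - Fglob fij xstar.
pose c := `|gap st1| + 2 * B.
(* The pathwise invariant. The exponent [k %% q] counts the iterations since the last multiple of
   [q], so the bound on the error of [v_i] grows by 4 per iteration and never beyond [cv / k]. *)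
pose P k (st : state R d m) :=
  [/\ forall i, Om (sx st i), spread (sx st) <= b1 k, avg (sd st) = avg (sv st),
    forall i, enorm (sv st i - grad (floc fij i) (sx st i))
      <= cs * 4 ^+ (k %% q) / k%:R &
    spread (sd st) <= b2 k /\ gap st <= c / k%:R].
have P1 : P 1%N st1.
  split=> // [i|]; last first.
    split=> //; rewrite divr1 (le_trans (ler_norm _)) // lerDl; lra.
  rewrite [X in enorm X](_ : _ = 0) ?enorm0; last exact: subrr.
  by rewrite divr1 mulr_ge0 // exprn_ge0.
have Pstep k st (S : Samp n (s k)) : (0 < k)%N -> P k st ->
    P k.+1 (dstep fij W lmo q gam st S).
  move=> k0 [Ox bx dv ve [bd hk]]; set st' := dstep _ _ _ _ _ _ _.
  have Ox' i : Om (sx st' i) by exact: (sx_step_in fij q cOm Wmix lmoP S k0 Ox i).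
  have bx' : spread (sx st') <= b1 k.+1.
    apply: le_trans (b1_step k k0).
    apply: le_trans (spread_sx_step fij q m0 OmM (Wlam d) lmoP S k0 Ox) _.
    by rewrite lerD2r ler_wpM2l.
  have kk : A1 / k.+1%:R <= A1 / k%:R.
    by rewrite ler_wpM2l // lef_pV2 ?posrE ?ltr0n // ler_nat.
  have LD i : `|L| * enorm (sx st' i - sx st i) <= `|L| * D / k%:R.
    rewrite -mulrA ler_wpM2l //.
    apply: le_trans (sx_step_dist fij q m0 OmM Wmix lmoP S k0 Ox i) _.
    rewrite /D [leRHS]mulrDl lerD2r -[2 * A1 / _]mulrA [leRHS]mulr_natl mulr2n.
    rewrite lerD //.
      exact: le_trans (le_trans bx' (b1_le _ _)) kk.
    exact: le_trans bx (b1_le _ k0).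
  have vstep i : enorm (sv st' i - sv st i) <= Dv / k%:R.
    apply: le_trans (sv_step_dist q n0 cOm sf Wmix lmoP s0 S k0 Ox i) _.
    by rewrite /Dv mulrDl lerD // (le_trans (ve i)).
  split=> //.
  - exact: (avg_sd_step fij q lmo Wmix S dv).
  - move=> i; have [kq|kq] := boolP (k.+1 %% q == 0)%N.
      rewrite (sv_step_checkpoint cOm sf Wmix lmoP S k0 Ox i kq) subrr enorm0.
      by rewrite divr_ge0 // mulr_ge0 // exprn_ge0.
    apply: le_trans (sv_step_error n0 cOm sf Wmix lmoP s0 S k0 Ox i kq) _.
    (* Away from a reset the residue of [k.+1] is that of [k] plus one, which matches the growth
       lemma. *)
    rewrite modnS /dvdn (negbTE kq).
    apply: le_trans (epoch_error_growth k0 cs0 (ve i)).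
    by rewrite lerD2l /cs -mulrA ler_wpM2l.
  split.
    apply: le_trans (b2_step k k0).
    have Dvk : 0 <= Dv / k%:R by rewrite divr_ge0.
    apply: le_trans (spread_sd_step m0 lam0 (Wlam d) Dvk vstep) _.
    by rewrite lerD ?ler_wpM2l // !mulrA.
  have ve' i := le_trans (ve i) (cv_le k).
  apply: le_trans (Fglob_step q m0 n0 cOm OmM sf Wmix lmoP S k0 Ox cf Oxs dv ve') _.
  apply: le_trans (frank_wolfe_recursion k0 B0 _ hk); last first.
    by rewrite /c lerDr.
  rewrite -addrA lerD2l.
  have -> : B / k%:R ^+ 2 = 2 / k%:R * (4 * M * (E / k%:R)) + `|L| * (4 * M / k%:R) ^+ 2.
    by rewrite /B; field; rewrite pnatr_eq0 -lt0n.
  rewrite lerD2r ler_wpM2l ?divr_ge0 // ler_wpM2l ?mulr_ge0 //.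
  rewrite /E !mulrDl -mulrA !lerD //.
    by rewrite ler_wpM2l // (le_trans bx) ?b1_le.
  by rewrite (le_trans bd) ?b2_le.
exists c, 1%N => k k0.
apply: (expect_from_dist n0 (P := P)) => // st; rewrite addn1 prednK //.
(* Optimality of [xstar] makes the gap nonnegative, so the one-sided bound controls the absolute
   value. *)
move=> [Ox _ _ _ [_ hk]]; rewrite ger0_norm // subr_ge0.
by apply: xsmin; exact: convex_setv_avg.
Qed.
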